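(* Let $a:\mathbb{N}\times\mathbb{N}\to\mathbb{C}$ be an arithmetic function of two variables. If the series $$A(q_1,q_2):=q_1q_2\sum_{k_1,k_2=1}^\infty a(k_1q_1,k_2q_2)$$ converges for every $q_1,q_2\in\mathbb{N}$, then for $f(q_1,q_2)=\sum_{d_1\mid q_1,\,d_2\mid q_2}A(d_1,d_2)\mu(q_1/d_1)\mu(q_2/d_2)$ we have, for all $q_1,q_2\in\mathbb{N}$, $$f(q_1,q_2)=\sum_{n_1,n_2=1}^\infty a(n_1,n_2)\,c_{q_1}(n_1)\,c_{q_2}(n_2).$$
   Context: $\mathbb{N}=\{1,2,\dots\}$. $c_q(n)=\sum_{1\le k\le q,\,(k,q)=1}\exp(2\pi i kn/q)$ is the Ramanujan sum; $\mu$ is the Möbius function. Double series $\sum_{k_1,k_2=1}^\infty$ are understood as limits of the partial sums over $k_1\le x$, $k_2\le y$ as $x,y\to\infty$. *)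

(* Defs.v *)
From HB Require Import structures.
From mathcomp Require Import all_boot all_order all_algebra.
From mathcomp Require Import all_classical all_reals all_analysis.
From mathcomp Require Export complex.
Set Implicit Arguments.
Unset Strict Implicit.
Unset Printing Implicit Defensive.
Import Order.TTheory GRing.Theory Num.Theory.
Import numFieldNormedType.Exports.
Local Open Scope classical_set_scope.
Local Open Scope ring_scope.
Local Open Scope complex_scope.

Definition moebius (n : nat) : int :=
  if (0 < n)%N && all (fun p => logn p n == 1%N) (primes n)
  then (-1) ^+ size (primes n) else 0.

Definition cexp (R : realType) (z : R[i]) : R[i] :=
  (expR (complex.Re z))%:C * (cos (complex.Im z) +i* sin (complex.Im z)).

Definition ramanujan_sum (R : realType) (q n : nat) : R[i] :=
  \sum_(1 <= k < q.+1 | coprime k q)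
    cexp (2 * pi%:C * 'i%C * k%:R * n%:R / q%:R).

(* The topology on R[i] is the one induced by the complex modulus; it is carried
   by the alias R[i]^o. *)
Definition partial_sum2 (R : realType) (u : nat -> nat -> R[i])
    (xy : nat * nat) : R[i]^o :=
  \sum_(1 <= k1 < xy.1.+1) \sum_(1 <= k2 < xy.2.+1) u k1 k2.

(* Both bounds tend to infinity independently (Pringsheim). *)
Definition has_sum2 (R : realType) (u : nat -> nat -> R[i]) (s : R[i]) : Prop :=
  partial_sum2 u xy @[xy --> (\oo, \oo)] --> (s : R[i]^o).

Definition summable2 (R : realType) (u : nat -> nat -> R[i]) : Prop :=
  cvg (partial_sum2 u xy @[xy --> (\oo, \oo)]).

Definition sum2 (R : realType) (u : nat -> nat -> R[i]) : R[i] :=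
  lim (partial_sum2 u xy @[xy --> (\oo, \oo)]).

Definition multiples_sum (R : realType) (a : nat -> nat -> R[i])
    (q1 q2 : nat) : R[i] :=
  q1%:R * q2%:R * sum2 (fun k1 k2 => a (k1 * q1)%N (k2 * q2)%N).

Definition moebius_transform2 (R : realType) (A : nat -> nat -> R[i])
    (q1 q2 : nat) : R[i] :=
  \sum_(d1 <- divisors q1) \sum_(d2 <- divisors q2)
    A d1 d2 * (moebius (q1 %/ d1)%N)%:~R * (moebius (q2 %/ d2)%N)%:~R.

(* Main.v *)
(** Detecting [coprime k q] by the Moebius function and summing over the roots of
    unity gives [c_q(n) = \sum_(d | q, d | n) d mu(q / d)].  Substituting this in
    the partial sum of the right-hand side up to [(x, y)] writes it as a finite
    combination, over the divisors [d1] of [q1] and [d2] of [q2], of the partial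
    sums up to [(x / d1, y / d2)] of the series defining [A(d1, d2)], and the
    limit can be taken term by term. *)
Require Import Defs.
From mathcomp Require Import all_boot all_order all_algebra.
From mathcomp Require Import all_classical all_reals all_analysis.
From mathcomp Require Import ring lra.
Import Order.TTheory GRing.Theory Num.Theory.
Import numFieldNormedType.Exports.
Local Open Scope classical_set_scope.
Local Open Scope ring_scope.
Local Open Scope complex_scope.

(** * The Möbius function and sums over divisors *)

Lemma moebius_primeM_coprime (p e : nat) :
  prime p -> (0 < e)%N -> ~~ (p %| e)%N -> moebius (p * e) = - moebius e.
Proof.
move=> p_pr e_gt0 pNe; have p_gt0 := prime_gt0 p_pr.
have pNprimes : p \notin primes e by rewrite mem_primes p_pr e_gt0.
have primes_pe : perm_eq (primes (p * e)) (p :: primes e).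
  apply: uniq_perm; rewrite ?primes_uniq //= ?pNprimes ?primes_uniq // => r.
  by rewrite primesM // primes_prime // !inE.
rewrite /moebius muln_gt0 p_gt0 e_gt0 (perm_size primes_pe) /=.
rewrite (perm_all _ primes_pe) /= lognM // logn_prime // eqxx.
rewrite [logn p e]lognE p_pr e_gt0 (negbTE pNe) /=.
rewrite (@eq_in_all _ _ (fun r => logn r e == 1%N)) => [|r r_e]; last first.
  rewrite lognM // logn_prime //; case: (eqVneq r p) => // rp.
  by rewrite -rp r_e in pNprimes.
by case: ifP => _; rewrite ?oppr0 // exprS mulN1r.
Qed.

Lemma moebius_primeM_dvd (p e : nat) :
  prime p -> (p %| e)%N -> moebius (p * e) = 0.
Proof.
move=> p_pr p_e; rewrite /moebius; case: ifP => // /andP[pe_gt0 /allP lg1].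
move: pe_gt0; rewrite muln_gt0 => /andP[p_gt0 e_gt0].
have /lg1 : p \in primes (p * e).
  by rewrite mem_primes p_pr muln_gt0 p_gt0 e_gt0 dvdn_mulr.
rewrite lognM // logn_prime // eqxx add1n eqSS.
by rewrite [logn p e]lognE p_pr e_gt0 p_e.
Qed.

(* For a prime [p %| m], the divisors [e] and [p * e] with [p] not dividing [e]
   cancel, and the divisors divisible by [p ^ 2] contribute nothing. *)
Lemma sum_moebius (m : nat) :
  (0 < m)%N -> \sum_(d <- divisors m) moebius d = (m == 1%N)%:R.
Proof.
move=> m_gt0; have [->|m_neq1] := eqVneq m 1%N; first by rewrite big_seq1.
have m_gt1 : (1 < m)%N by case: m m_gt0 m_neq1 => [|[]].
pose p := pdiv m; have p_pr : prime p by exact: pdiv_prime.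
have p_gt0 := prime_gt0 p_pr; have p_m : (p %| m)%N := pdiv_dvd m.
rewrite (bigID (fun d => p %| d)%N) /= -big_filter.
have -> : \sum_(d <- [seq d <- divisors m | p %| d]%N) moebius d =
          \sum_(e <- divisors (m %/ p)) moebius (p * e).
  rewrite -(big_map (muln p) predT moebius); apply: perm_big.
  apply: uniq_perm; first by rewrite filter_uniq // divisors_uniq.
    rewrite map_inj_uniq ?divisors_uniq // => x y /eqP.
    by rewrite eqn_pmul2l // => /eqP.
  have mp_gt0 : (0 < m %/ p)%N by rewrite divn_gt0 // dvdn_leq.
  move=> d; rewrite mem_filter -dvdn_divisors //; apply/andP/mapP.
    move=> [/dvdnP[e ->] ped]; exists e; last by rewrite mulnC.
    by rewrite -dvdn_divisors // dvdn_divRL.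
  move=> [e]; rewrite -dvdn_divisors // => e_mp ->.
  by rewrite dvdn_mulr // mulnC -dvdn_divRL.
rewrite (bigID (fun d => p %| d)%N) /= big1 ?add0r => [|e]; last first.
  exact: moebius_primeM_dvd.
rewrite -[X in X + _]big_filter -[X in _ + X]big_filter.
have -> : \sum_(e <- [seq e <- divisors (m %/ p) | ~~ (p %| e)%N]) moebius (p * e)
    = - \sum_(e <- [seq e <- divisors (m %/ p) | ~~ (p %| e)%N]) moebius e.
  rewrite -sumrN [LHS]big_seq [RHS]big_seq; apply: eq_bigr => e.
  rewrite mem_filter -dvdn_divisors ?divn_gt0 ?(dvdn_leq m_gt0) // => /andP[pNe e_mp].
  rewrite moebius_primeM_coprime //; apply: dvdn_gt0 e_mp.
  by rewrite divn_gt0 // dvdn_leq.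
(* Since [p] divides [m], Gauss's lemma shows that [m] and [m %/ p] have the same divisors prime to
   [p], so the two remaining sums cancel. *)
apply/eqP; rewrite addrC subr_eq0; apply/eqP/perm_big.
apply: uniq_perm; rewrite ?filter_uniq ?divisors_uniq // => e.
rewrite !mem_filter -!dvdn_divisors ?divn_gt0 ?(dvdn_leq m_gt0) //.
have [//|pNe] /= := boolP (p %| e)%N.
rewrite dvdn_divRL // Gauss_dvd ?p_m ?andbT //.
by rewrite coprime_sym prime_coprime.
Qed.

Lemma sum_divisors_codiv (V : nmodType) (q : nat) (F : nat -> V) :
  (0 < q)%N ->
  \sum_(d <- divisors q) F d = \sum_(d <- divisors q) F (q %/ d)%N.
Proof.
move=> q_gt0; rewrite -(big_map (divn q) predT F); apply: perm_big.
have divK d : (d %| q)%N -> (q %/ (q %/ d))%N = d.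
  by move=> d_q; rewrite divnA // mulKn.
apply: uniq_perm; rewrite ?divisors_uniq //.
  rewrite map_inj_in_uniq ?divisors_uniq // => x y.
  by rewrite -!dvdn_divisors // => /divK{2}<- /divK{2}<- ->.
move=> d; rewrite -dvdn_divisors //; apply/idP/mapP => [d_q|[e]].
  by exists (q %/ d)%N; rewrite -?dvdn_divisors ?dvdn_div ?divK.
by rewrite -dvdn_divisors // => e_q ->; exact: dvdn_div.
Qed.

Lemma sum_nat_dvdn (V : nmodType) (d x : nat) (F : nat -> V) :
  (0 < d)%N ->
  \sum_(1 <= k < x.+1 | (d %| k)%N) F k =
  \sum_(1 <= j < (x %/ d).+1) F (j * d)%N.
Proof.
move=> d_gt0; elim: x => [|x IHx]; first by rewrite div0n !big_geq.
(* Passing from [x] to [x.+1] raises the quotient by [d] exactly when [d] divides [x.+1], and the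
   new index [j] then satisfies [j * d = x.+1]. *)
rewrite big_mkcond big_nat_recr //= -big_mkcond IHx divnS //.
case: ifP => [d_x|_]; last by rewrite addr0 add0n.
rewrite add1n [RHS]big_nat_recr //=; congr (_ + F _).
by have := divnS x d_gt0; rewrite d_x add1n => <-; rewrite divnK.
Qed.

(** By [sum_moebius], the indicator of [coprime k q] is the sum of [moebius d] over [d] dividing
    [gcdn k q]; exchanging the sums leaves the multiples of [d] up to [q]. *)
Lemma sum_coprime (V : pzRingType) (q : nat) (F : nat -> V) :
  (0 < q)%N ->
  \sum_(1 <= k < q.+1 | coprime k q) F k =
  \sum_(d <- divisors q)
     (moebius d)%:~R * \sum_(1 <= j < (q %/ d).+1) F (j * d)%N.
Proof.
move=> q_gt0; transitivity (\sum_(1 <= k < q.+1) \sum_(d <- divisors q)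
   (if (d %| k)%N then (moebius d)%:~R * F k else 0)).
  rewrite big_mkcond; apply: eq_big_nat => k /andP[k_gt0 _].
  rewrite -big_mkcond -mulr_suml -rmorph_sum /=.
  have -> : \sum_(d <- divisors q | (d %| k)%N) moebius d =
            \sum_(d <- divisors (gcdn k q)) moebius d.
    rewrite -big_filter; apply: perm_big.
    apply: uniq_perm; rewrite ?filter_uniq ?divisors_uniq // => d.
    by rewrite mem_filter -!dvdn_divisors ?gcdn_gt0 ?k_gt0 // dvdn_gcd.
  rewrite sum_moebius ?gcdn_gt0 ?k_gt0 // -/(coprime k q).
  by case: coprime; rewrite ?mul1r ?mul0r.
rewrite exchange_big /= big_seq [RHS]big_seq; apply: eq_bigr => d.
rewrite -dvdn_divisors // => d_q.
rewrite -big_mkcond -sum_nat_dvdn ?(dvdn_gt0 q_gt0) //.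
by rewrite mulr_sumr.
Qed.

(** * Roots of unity and the divisor formula for Ramanujan sums *)

Section CircleExponential.
Variable R : realType.
Implicit Types (t : R) (k n q d : nat).

Definition cis t : R[i] := cos t +i* sin t.

Lemma cisD t u : cis (t + u) = cis t * cis u.
Proof.
by apply/eqP; rewrite /cis eq_complex /= cosD sinD [sin t * _ + _]addrC !eqxx.
Qed.

Lemma cis0 : cis 0 = 1.
Proof. by rewrite /cis cos0 sin0. Qed.

Lemma cisMn t n : cis (t *+ n) = cis t ^+ n.
Proof. by elim: n => [|n IHn]; rewrite ?cis0 // mulrS cisD IHn exprS. Qed.

Lemma cis2pi : cis (pi *+ 2) = 1.
Proof. by rewrite /cis cos2pi sin2pi. Qed.

Lemma cis_neq1 t : 0 < t < pi *+ 2 -> cis t != 1.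
Proof.
move=> /andP[t_gt0 t_lt]; apply/eqP => /(congr1 (@complex.Re R)) /= cos_t.
(* At the half angle the sine is positive, and [cos t] is 1 minus twice its square, hence less than
   1. *)
have th : 0 < t / 2 < pi by rewrite divr_gt0 //= ltr_pdivrMr // mulr_natr.
have := sin_gt0_pi th; have := cos2Dsin2 (t / 2).
move: cos_t; rewrite -{1}[t](@divfK _ 2) // mulr_natr cos_mulr2n; nra.
Qed.

Lemma cexp_rootE k n q :
  cexp (2 * pi%:C * 'i%C * k%:R * n%:R / q%:R) =
  cis (pi *+ 2 * (k%:R * n%:R / q%:R)) :> R[i].
Proof.
have -> : 2 * pi%:C * 'i%C * k%:R * n%:R / q%:R =
    0 +i* (pi *+ 2 * (k%:R * n%:R / q%:R)) :> R[i].
  rewrite -!(rmorph_nat (real_complex R)) -fmorphV.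
  by apply/eqP; rewrite eq_complex /=; apply/andP; split; apply/eqP; ring.
by rewrite /cexp /= expR0 mul1r.
Qed.

Lemma sum_cexp_root q n : (0 < q)%N ->
  \sum_(1 <= k < q.+1) cexp (2 * pi%:C * 'i%C * k%:R * n%:R / q%:R) =
  (if (q %| n)%N then q%:R else 0) :> R[i].
Proof.
move=> q_gt0; have q_neq0 : q%:R != 0 :> R by rewrite pnatr_eq0 -lt0n.
pose w := cis (pi *+ 2 * (n%:R / q%:R)).
(* Dropping the full turns brings the angle into the interval from 0 to [pi *+ 2], where [cis_neq1]
   applies unless [q] divides [n]. *)
have wE : w = cis (pi *+ 2 * ((n %% q)%N%:R / q%:R)).
  have -> : w = cis (pi *+ 2 *+ (n %/ q) + pi *+ 2 * ((n %% q)%N%:R / q%:R)).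
    rewrite /w {1}(divn_eq n q) natrD natrM -[pi *+ 2 *+ _]mulr_natr.
    by congr cis; field.
  by rewrite cisD cisMn cis2pi expr1n mul1r.
transitivity (\sum_(1 <= k < q.+1) w ^+ k).
  apply: eq_bigr => k _; rewrite cexp_rootE -cisMn -mulr_natr.
  by congr cis; ring.
rewrite big_add1 /= big_mkord.
under eq_bigr do rewrite exprS.
rewrite -mulr_sumr; have [q_n|qNn] := boolP (q %| n)%N.
  have -> : w = 1 by rewrite wE (eqP q_n) mul0r mulr0 cis0.
  by under eq_bigr do rewrite expr1n; rewrite sumr_const card_ord mul1r.
have w_neq1 : w != 1.
  have pi2_gt0 : 0 < pi *+ 2 :> R by rewrite pmulrn_lgt0 ?pi_gt0.
  rewrite wE; apply: cis_neq1.
  have r_gt0 : (0 < n %% q)%N by rewrite lt0n.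
  apply/andP; split; first by rewrite mulr_gt0 ?divr_gt0 ?ltr0n.
  rewrite -[ltRHS]mulr1 ltr_pM2l //.
  by rewrite ltr_pdivrMr ?ltr0n // mul1r ltr_nat ltn_mod.
(* The geometric sum times [w - 1] is [w ^+ q - 1], and [w] is a [q]-th root of unity. *)
have /eqP : (w - 1) * (\sum_(i < q) w ^+ i) = 0.
  have turns : pi *+ 2 * (n%:R / q%:R) *+ q = pi *+ 2 *+ n :> R.
    by rewrite -[LHS]mulr_natr -[RHS]mulr_natr; field.
  by rewrite -subrX1 /w -cisMn turns cisMn cis2pi expr1n subrr.
by rewrite mulf_eq0 subr_eq0 (negbTE w_neq1) /= => /eqP ->; rewrite mulr0.
Qed.

(** Indexing by the codivisor turns the index [k] into [j * (q %/ d)], so that [k / q = j / d] and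
    the inner sum is a complete sum over the [d]-th roots of unity. *)
Lemma ramanujan_sumE q n : (0 < q)%N ->
  ramanujan_sum R q n =
  \sum_(d <- divisors q | (d %| n)%N) d%:R * (moebius (q %/ d))%:~R.
Proof.
move=> q_gt0; rewrite /ramanujan_sum sum_coprime // sum_divisors_codiv //.
rewrite [RHS]big_mkcond big_seq [RHS]big_seq; apply: eq_bigr => d.
rewrite -dvdn_divisors // => d_q; have d_gt0 := dvdn_gt0 q_gt0 d_q.
have qd_gt0 : (0 < q %/ d)%N by rewrite divn_gt0 // dvdn_leq.
rewrite divnA // mulKn //.
under eq_bigr => j _.
  have -> : 2 * pi%:C * 'i%C * (j * (q %/ d))%:R * n%:R / q%:R =
            2 * pi%:C * 'i%C * j%:R * n%:R / d%:R :> R[i].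
    rewrite -{2}(divnK d_q) !natrM; field.
    by rewrite !pnatr_eq0 -!lt0n d_gt0 qd_gt0.
  over.
by rewrite sum_cexp_root //; case: ifP => _; rewrite ?mulr0 // mulrC.
Qed.

Lemma sum_mul_ramanujan q x (F : nat -> R[i]) : (0 < q)%N ->
  \sum_(1 <= n < x.+1) F n * ramanujan_sum R q n =
  \sum_(d <- divisors q) d%:R * (moebius (q %/ d))%:~R *
    \sum_(1 <= k < (x %/ d).+1) F (k * d)%N.
Proof.
move=> q_gt0; under eq_bigr do rewrite ramanujan_sumE // mulr_sumr big_mkcond.
rewrite exchange_big /= big_seq [RHS]big_seq; apply: eq_bigr => d.
rewrite -dvdn_divisors // => /(dvdn_gt0 q_gt0) d_gt0.
rewrite -big_mkcond -sum_nat_dvdn // mulr_sumr.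
by apply: eq_bigr => n _; rewrite mulrC.
Qed.

End CircleExponential.

(** * Double partial sums and passage to the limit *)

Lemma partial_sum2_ramanujan (R : realType) (a : nat -> nat -> R[i])
    (q1 q2 : nat) (xy : nat * nat) :
  (0 < q1)%N -> (0 < q2)%N ->
  partial_sum2 (fun n1 n2 : nat =>
    a n1 n2 * ramanujan_sum R q1 n1 * ramanujan_sum R q2 n2) xy =
  \sum_(d1 <- divisors q1) \sum_(d2 <- divisors q2)
    d1%:R * d2%:R * (moebius (q1 %/ d1))%:~R * (moebius (q2 %/ d2))%:~R *
    partial_sum2 (fun k1 k2 => a (k1 * d1)%N (k2 * d2)%N)
      (xy.1 %/ d1, xy.2 %/ d2)%N.
Proof.
move=> q1_gt0 q2_gt0; rewrite /partial_sum2.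
(* The factor depending on [n1] alone leaves the inner sum, so that [sum_mul_ramanujan] applies
   first in [n2], then in [n1]. *)
under eq_bigr => n1 _.
  under eq_bigr do rewrite mulrAC.
  rewrite -mulr_suml sum_mul_ramanujan //.
  over.
rewrite sum_mul_ramanujan //; apply: eq_bigr => d1 _.
rewrite exchange_big /= mulr_sumr; apply: eq_bigr => d2 _.
by rewrite -mulr_sumr mulrA; congr (_ * _); ring.
Qed.

(** Convergence is asked only at entries of [r]: for a list of divisors, membership gives the
    positivity under which the series are known to converge. *)
Lemma cvg_sum_seq (K : numFieldType) (V : normedModType K) (T : Type)
    (F : set_system T) (FF : Filter F) (I : eqType) (r : seq I)
    (f : I -> T -> V) (l : I -> V) :
  (forall i, i \in r -> f i x @[x --> F] --> l i) ->
  \sum_(i <- r) f i x @[x --> F] --> \sum_(i <- r) l i.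
Proof.
move=> fl; rewrite big_seq.
rewrite (_ : (fun x => _) = fun x => \sum_(i <- r | i \in r) f i x).
  by apply: cvg_big => //; exact: add_continuous.
by apply/funext => x; rewrite big_seq.
Qed.

(** Rescaling the two bounds keeps them tending to infinity independently, so the rescaled partial
    sums have the same limit. *)
Lemma cvg_div2 (d1 d2 : nat) : (0 < d1)%N -> (0 < d2)%N ->
  (xy.1 %/ d1, xy.2 %/ d2)%N @[xy --> (\oo, \oo)] --> (\oo, \oo).
Proof.
move=> d1_gt0 d2_gt0; pose F := filter_prod (\oo : set_system nat) \oo.
have cvg1 : (xy.1 %/ d1)%N @[xy --> F] --> \oo.
  by apply: cvg_comp (cvg_divnr _ d1_gt0); exact: cvg_fst.
have cvg2 : (xy.2 %/ d2)%N @[xy --> F] --> \oo.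
  by apply: cvg_comp (cvg_divnr _ d2_gt0); exact: cvg_snd.
exact: (cvg_pair cvg1 cvg2).
Qed.

Theorem theorem4p2 (R : realType) (a : nat -> nat -> R[i])
    (hA : forall q1 q2 : nat, (0 < q1)%N -> (0 < q2)%N ->
       summable2 (fun k1 k2 : nat => a (k1 * q1)%N (k2 * q2)%N)) :
  forall q1 q2 : nat, (0 < q1)%N -> (0 < q2)%N ->
    has_sum2
      (fun n1 n2 : nat =>
         a n1 n2 * ramanujan_sum R q1 n1 * ramanujan_sum R q2 n2)
      (moebius_transform2 (multiples_sum a) q1 q2).
Proof.
move=> q1 q2 q1_gt0 q2_gt0; rewrite /has_sum2 /moebius_transform2.
rewrite (funext (fun xy => partial_sum2_ramanujan _ a _ _ xy q1_gt0 q2_gt0)).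
apply: cvg_sum_seq => d1.
rewrite -dvdn_divisors // => /(dvdn_gt0 q1_gt0) d1_gt0.
apply: cvg_sum_seq => d2.
rewrite -dvdn_divisors // => /(dvdn_gt0 q2_gt0) d2_gt0.
rewrite /multiples_sum; set s := sum2 _.
rewrite [X in _ --> X](_ : _ = d1%:R * d2%:R * (moebius (q1 %/ d1))%:~R *
   (moebius (q2 %/ d2))%:~R * s); last by ring.
apply: cvgMl_tmp; apply: cvg_comp (cvg_div2 _ _ d1_gt0 d2_gt0) _.
(* [summable2] is convergence to the [lim] that defines [sum2], which is [s] here. *)
exact: hA.
Qed.
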